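(* Let $d\ge2$ and fix $n\in\mathbb{N}$. Then \[ \frac{1}{\rho^{(d)}_{\min}(n)}\le q^{(d)}(n)\le\frac{2n^{2d}\ln n}{\rho^{(d)}_{\min}(n)}. \]
   Context: $X_n=\{x_1,\dots,x_n\}$. A $d$-ary question is an ordered partition $(S_1,\dots,S_d)$ of $X_n$. A $d$-ary search tree has internal nodes labeled by $d$-ary questions with $d$ outgoing edges (answers ''$x\in S_j$'') and leaves labeled by elements of $X_n$ (each at most once); it uses $\mathcal{Q}$ if all its questions lie in $\mathcal{Q}$; it is valid for $\pi$ if every element of the support labels a leaf; its cost is $\sum_i\pi(x_i)\cdot(\text{depth of }x_i)$. $\mathcal{Q}$ is optimal if for every distribution $\pi$ on $X_n$ some valid tree using $\mathcal{Q}$ achieves the minimum cost over all valid $d$-ary search trees for $\pi$; $q^{(d)}(n)$ is the minimum size of an optimal $\mathcal{Q}$. A distribution $\mu$ is $d$-adic if every nonzero probability is $d^{-\ell}$ for a positive integer $\ell$. For non-constant $d$-adic $\mu$, $\mathrm{Div}(\mu)$ is the set of ordered partitions $(D_1,\dots,D_d)$ of $X_n$ with $\mu(D_i)=1/d$ for all $i$. Let $K$ be the set of vectors $\bar k=(k_1,\dots,k_d)\in\{0,\dots,n\}^d$ with $\sum k_i=n$. For a collection $\mathcal{D}$ of ordered partitions, $\mathcal{D}_{\bar k}$ is the subcollection with $|D_i|=k_i$ for all $i$, $\rho_{\bar k}(\mathcal{D})=|\mathcal{D}_{\bar k}|/\binom{n}{k_1,\dots,k_d}$, and $\rho(\mathcal{D})=\max_{\bar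 k\in K}\rho_{\bar k}(\mathcal{D})$. Finally $\rho^{(d)}_{\min}(n)$ is the minimum of $\rho(\mathrm{Div}(\mu))$ over all non-constant $d$-adic distributions $\mu$ on $X_n$. *)

(* Defs.v *)
From HB Require Import structures.
From mathcomp Require Import all_boot all_order all_algebra.
From mathcomp Require Import boolp reals exp.

Set Implicit Arguments.
Unset Strict Implicit.
Unset Printing Implicit Defensive.
Import Order.TTheory GRing.Theory Num.Theory.
Local Open Scope ring_scope.

(* X_n is 'I_n. An ordered partition (S_1, ..., S_d) of X_n, with possibly
   empty parts, is encoded by the map sending x to the unique index j such that
   x lies in S_j. *)
Definition question (d n : nat) := {ffun 'I_n -> 'I_d}.

Definition part (d n : nat) (D : question d n) (j : 'I_d) : {set 'I_n} :=
  [set x | D x == j].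

Definition distribution (R : realType) (n : nat) (p : 'I_n -> R) : Prop :=
  (forall x, 0 <= p x) /\ \sum_x p x = 1.

Definition support (R : realType) (n : nat) (p : 'I_n -> R) : {set 'I_n} :=
  [set x | p x != 0].

(* A leaf may carry no label: a tree all of whose internal nodes have exactly d
   children has 1 mod (d - 1) leaves, so for d > 2 a distribution need not
   admit a valid tree with every leaf labeled. *)
Inductive tree (d n : nat) : Type :=
| Leaf of option 'I_n
| Node of question d n & ('I_d -> tree d n).

Arguments Leaf {d n}.
Arguments Node {d n}.

(* The labeled leaves, each given by its label and its depth. *)
Fixpoint leaves (d n : nat) (t : tree d n) : seq ('I_n * nat) :=
  match t with
  | Leaf None => [::]
  | Leaf (Some x) => [:: (x, 0%N)]
  | Node _ c =>
      flatten [seq [seq (p.1, p.2.+1) | p <- leaves (c j)] | j <- enum 'I_d]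
  end.

Definition labels (d n : nat) (t : tree d n) : seq 'I_n :=
  [seq p.1 | p <- leaves t].

(* The label of each leaf agrees with all answers on the path to that leaf. *)
Fixpoint consistent (d n : nat) (t : tree d n) : Prop :=
  match t with
  | Leaf _ => True
  | Node D c => forall j : 'I_d,
      consistent (c j) /\ {in labels (c j), forall x, x \in part D j}
  end.

Definition search_tree (d n : nat) (t : tree d n) : Prop :=
  consistent t /\ uniq (labels t).

Fixpoint uses (d n : nat) (Q : {set question d n}) (t : tree d n) : Prop :=
  match t with
  | Leaf _ => True
  | Node D c => D \in Q /\ forall j : 'I_d, uses Q (c j)
  end.

Definition valid (R : realType) (d n : nat) (p : 'I_n -> R) (t : tree d n) :
    Prop :=
  search_tree t /\ {in support p, forall x, x \in labels t}.

(* In a search tree at most one leaf is labeled x, so the sum has at most one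
   term; it is 0 if there is no such leaf, in which case p x = 0 whenever the
   tree is valid for p. *)
Definition depth (d n : nat) (t : tree d n) (x : 'I_n) : nat :=
  (\sum_(p <- leaves t | p.1 == x) p.2)%N.

Definition cost (R : realType) (d n : nat) (p : 'I_n -> R) (t : tree d n) : R :=
  \sum_x p x * (depth t x)%:R.

Definition optimal (R : realType) (d n : nat) (Q : {set question d n}) : Prop :=
  forall p : 'I_n -> R, distribution p ->
  exists t : tree d n, [/\ valid p t, uses Q t &
    forall t' : tree d n, valid p t' -> cost p t <= cost p t'].

(* The minimum is over a nonempty collection: the set of all questions is
   optimal. *)
Definition qmin (R : realType) (d n : nat) : nat :=
  #|[arg min_(Q < [set: question d n] | `[< optimal R Q >]) #|Q| ]|.

Definition dadic (R : realType) (d n : nat) (mu : 'I_n -> R) : Prop :=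
  distribution mu /\
  forall x, mu x != 0 -> exists2 l : nat, (0 < l)%N & mu x = d%:R ^- l.

(* Constant as a random variable, not as a function on X_n. *)
Definition nonconstant (R : realType) (n : nat) (mu : 'I_n -> R) : Prop :=
  (1 < #|support mu|)%N.

Definition Div (R : realType) (d n : nat) (mu : 'I_n -> R) :
    {set question d n} :=
  [set D : question d n | [forall j, \sum_(x in part D j) mu x == d%:R^-1]].

Definition sizes (d n : nat) : {set {ffun 'I_d -> 'I_n.+1}} :=
  [set k : {ffun 'I_d -> 'I_n.+1} | (\sum_i k i)%N == n].

Definition multinomial (d n : nat) (k : {ffun 'I_d -> 'I_n.+1}) : nat :=
  (n`! %/ \prod_i (k i)`!)%N.

Definition of_sizes (d n : nat) (A : {set question d n})
    (k : {ffun 'I_d -> 'I_n.+1}) : {set question d n} :=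
  [set D in A | [forall i, #|part D i| == k i :> nat]].

Definition rho_at (R : realType) (d n : nat) (k : {ffun 'I_d -> 'I_n.+1})
    (A : {set question d n}) : R :=
  #|of_sizes A k|%:R / (multinomial k)%:R.

Definition rho (R : realType) (d n : nat) (A : {set question d n}) : R :=
  \big[Num.max/0]_(k in sizes d n) rho_at R k A.

(* The minimum of rho (Div mu) over mu, written as a minimum over the finitely
   many values A of Div mu. As rho A <= 1, the initial value 1 is neutral as
   soon as some mu exists, which is the case if and only if d <= n. *)
Definition rho_min (R : realType) (d n : nat) : R :=
  \big[Num.min/1]_(A : {set question d n} |
      `[< exists mu : 'I_n -> R,
            [/\ dadic d mu, nonconstant mu & Div d mu = A] >]) rho R A.

(* Main.v *)
Require Import Defs.
From HB Require Import structures.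
From mathcomp Require Import all_boot all_order all_algebra.
From mathcomp Require Import boolp reals exp.
From mathcomp Require Import fingroup perm sequences.
From mathcomp Require Import zify lra.

Set Implicit Arguments.
Unset Strict Implicit.
Unset Printing Implicit Defensive.
Import Order.TTheory GRing.Theory Num.Theory.
Local Open Scope ring_scope.

(* Call a set Q of questions hitting if it meets Div(mu) for every non-constant
   d-adic mu. An optimal tree for such a mu puts each x at depth
   -log_d mu(x), so the root question of a tree lies in Div(mu); hence optimal
   sets are hitting. Averaging over the permutations of X_n, a single question
   meets at most a fraction rho(Div(mu)) of the permuted copies of Div(mu), which
   gives the lower bound.

   For the upper bound, a greedy choice of n ln n / rho_min questions of each of
   at most n^d types produces a hitting set, because mu is determined by depths
   smaller than n, so that there are at most n^n sets Div(mu). For d = 2 hitting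
   sets are optimal, but for d > 2 they need not be: an optimal tree may have up
   to d - 2 unlabeled leaves, and its depths then do not come from a d-adic
   distribution on X_n. For instance, for d = 3 and n = 4 a hitting set need not
   contain a question with part {x_3, x_4} that separates x_1 and x_2. This is
   repaired by adding, for each question D of the hitting set, each y and each
   choice of d - 2 further elements, the question that answers on those elements
   as D does on y; this costs a factor n^(d-1). *)

(** * Counting questions by the sizes of their parts *)

Lemma sum_ffun_ordS (I : finType) (n : nat) (F : {ffun 'I_n.+1 -> I} -> nat) :
  (\sum_f F f = \sum_i \sum_(g : {ffun 'I_n -> I})
     F [ffun x => oapp g i (unlift ord0 x)])%N.
Proof.
rewrite pair_bigA /=; apply: reindex.
exists (fun f : {ffun 'I_n.+1 -> I} =>
  (f ord0, [ffun x : 'I_n => f (lift ord0 x)])).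
  move=> [i g] _ /=; rewrite ffunE unlift_none /=; congr pair.
  by apply/ffunP => x; rewrite !ffunE liftK.
move=> f _; apply/ffunP => x; rewrite ffunE.
by case: unliftP => [y ->|->] //=; rewrite ffunE.
Qed.

(** Induction on [n], sorting functions by their value [i] at [ord0]: the rest has fiber sizes [k]
    lowered by one at [i], so [i] contributes [k i] times the factorial of [n]. *)
Lemma card_ffun_fibers (I : finType) (n : nat) (k : I -> nat) :
  (\sum_i k i = n)%N ->
  (#|[set f : {ffun 'I_n -> I} | [forall i, (\sum_x (f x == i))%N == k i]]|
     * \prod_i (k i)`! = n`!)%N.
Proof.
have cardE m (h : I -> nat) :
    #|[set f : {ffun 'I_m -> I} | [forall i, (\sum_x (f x == i))%N == h i]]| =
    (\sum_(f : {ffun 'I_m -> I}) [forall i, (\sum_x (f x == i))%N == h i])%N.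
  by rewrite -sum1dep_card big_mkcond.
elim: n k => [|n IHn] k sum_k.
  have k0 i : k i = 0%N.
    by apply/eqP; move/eqP: sum_k; rewrite sum_nat_eq0 => /forallP/(_ i).
  rewrite big1 ?muln1 => [|i _]; last by rewrite k0.
  rewrite (_ : [set _ | _] = setT) ?cardsT ?card_ffun ?card_ord ?expn0 //.
  apply/setP => f; rewrite !inE; apply/forallP => i.
  by rewrite big_ord0 k0.
rewrite cardE sum_ffun_ordS big_distrl /=.
transitivity (\sum_i k i * n`!)%N; last by rewrite -big_distrl sum_k factS.
apply: eq_bigr => i _.
under eq_bigr => g _.
  rewrite (eq_forallb (P2 := fun j => (i == j) + (\sum_x (g x == j)) == k j)%N).
    over.
  move=> j; rewrite big_ord_recl ffunE unlift_none /=; congr (_ + _ == _)%N.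
  by apply: eq_bigr => x _; rewrite ffunE liftK.
have [k0|k_gt0] := posnP (k i).
  rewrite k0 mul0n big1 // => g _; apply/eqP; rewrite eqb0.
  by apply/forallPn; exists i; rewrite eqxx k0.
pose h j := (k j - (i == j))%N.
have kE j : k j = ((i == j) + h j)%N.
  by rewrite subnKC //; case: eqP => [<-|].
have sum_h : (\sum_j h j = n)%N.
  have sum1 : (\sum_j (i == j) = 1)%N.
    by rewrite (bigD1 i) //= eqxx big1 // => j; rewrite eq_sym => /negPf->.
  apply: succn_inj.
  by rewrite -sum_k (eq_bigr _ (fun j _ => kE j)) big_split /= sum1.
rewrite -(IHn h sum_h) cardE.
under eq_bigr => g _ do under eq_forallb => j do rewrite kE eqn_add2l.
rewrite mulnCA; congr (_ * _)%N.
rewrite !(bigD1 i (P := predT)) //= mulnA; congr (_ * _)%N.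
  by rewrite kE eqxx factS.
by apply: eq_bigr => j /negPf ij; rewrite kE eq_sym ij.
Qed.

Definition type_of (d n : nat) (D : question d n) : {ffun 'I_d -> 'I_n.+1} :=
  [ffun i => inord #|part D i|].

Lemma type_ofE (d n : nat) (D : question d n) i : type_of D i = #|part D i| :> nat.
Proof.
by rewrite ffunE inordK // ltnS -[X in (_ <= X)%N](card_ord n) max_card.
Qed.

Lemma card_partE (d n : nat) (D : question d n) i :
  #|part D i| = (\sum_x (D x == i))%N.
Proof. by rewrite -sum1dep_card big_mkcond. Qed.

Lemma type_of_sizes (d n : nat) (D : question d n) : type_of D \in sizes d n.
Proof.
rewrite inE; apply/eqP; under eq_bigr => i _ do rewrite type_ofE card_partE.
rewrite exchange_big /= -[RHS](card_ord n) -sum1_card; apply: eq_bigr => x _.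
by rewrite (bigD1 (D x)) //= eqxx big1 // => i; rewrite eq_sym => /negPf->.
Qed.

Lemma mem_of_sizes (d n : nat) (A : {set question d n}) k D :
  (D \in of_sizes A k) = (D \in A) && (type_of D == k).
Proof.
rewrite inE; congr andb; apply/forallP/eqP => [Dk|<- i]; last by rewrite type_ofE.
by apply/ffunP => i; apply: val_inj; rewrite /= type_ofE (eqP (Dk i)).
Qed.

Lemma multinomial_mul (d n : nat) (k : {ffun 'I_d -> 'I_n.+1}) :
  k \in sizes d n ->
  (#|of_sizes [set: question d n] k| = multinomial k)%N /\
  (0 < multinomial k)%N.
Proof.
rewrite inE => /eqP /(card_ffun_fibers) cardM.
have f_gt0 : (0 < \prod_i (k i)`!)%N by apply: prodn_gt0 => i; apply: fact_gt0.
rewrite /multinomial -cardM mulnK //.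
have /setP eqA : of_sizes [set: question d n] k =
    [set f : {ffun 'I_n -> 'I_d} | [forall i, (\sum_x (f x == i))%N == k i]].
  apply/setP => D; rewrite !inE /=.
  by apply: eq_forallb => i; rewrite card_partE.
split; first by apply: eq_card.
by move: (fact_gt0 n); rewrite -cardM muln_gt0 => /andP[].
Qed.

Definition qperm (d n : nat) (D : question d n) (s : {perm 'I_n}) : question d n :=
  [ffun x => D (s x)].

Lemma type_of_qperm (d n : nat) (D : question d n) s : type_of (qperm D s) = type_of D.
Proof.
apply/ffunP => i; apply: val_inj; rewrite /= !type_ofE.
have -> : part (qperm D s) i = s @^-1: part D i by apply/setP=> x; rewrite !inE ffunE.
by rewrite (card_preimset _ (@perm_inj _ s)).
Qed.

(** Equal types mean equal multisets of answers, so the lists of answers differ by a permutation. *)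
Lemma type_of_eqP (d n : nat) (D D' : question d n) :
  type_of D = type_of D' -> exists s, D' = qperm D s.
Proof.
move=> eqDD'.
have /tuple_permP[s Ds] : perm_eq [tuple D' x | x < n] [tuple D x | x < n].
  apply/allP => i _; apply/eqP; rewrite /= !count_map -!sum1_count /=.
  have /ffunP/(_ i)/(congr1 val) := eqDD'.
  by rewrite /= !type_ofE !card_partE !sum1dep_card !card_partE.
exists s; apply/ffunP => x; rewrite ffunE.
have := congr1 (fun t => nth (D x) t x) Ds.
by rewrite -!tnth_nth !tnth_mktuple.
Qed.

(** Orbit counting: each question of the type of [D] is reached from [D] by equally many
    permutations. Hence a random permutation sends [D] into [A] with probability [rho_at] at that
    type. *)
Lemma card_qperm (d n : nat) (D : question d n) (A : {set question d n}) :
  (#|[set s | qperm D s \in A]| * multinomial (type_of D) =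
   #|of_sizes A (type_of D)| * n`!)%N.
Proof.
set k := type_of D.
pose N := #|[set s | qperm D s == D]|.
have cN D' : type_of D' = k -> #|[set s | qperm D s == D']| = N.
  move=> /esym/type_of_eqP[t ->].
  (* Translation by [t] matches the permutations sending [D] to [qperm D t] with the stabilizer of
     [D]. *)
  rewrite -(card_preimset _ (mulgI t)); apply: eq_card => s; rewrite !inE.
  apply/eqP/eqP => /ffunP e; apply/ffunP => x; rewrite !ffunE.
    by have := e (t^-1 x)%g; rewrite !ffunE permM permKV.
  by rewrite permM -[in RHS]e ffunE.
have count (B : {set question d n}) :
    #|[set s | qperm D s \in B]| = (#|of_sizes B k| * N)%N.
  rewrite -sum_nat_const.
  rewrite -sum1dep_card.
  rewrite (partition_big (qperm D) (mem (of_sizes B k))) /=.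
    apply: eq_bigr => D'; rewrite mem_of_sizes => /andP[BD' /eqP kD'].
    rewrite -(cN D' kD') -sum1dep_card; apply: eq_bigl => s.
    by case: eqP => [->|]; rewrite ?BD' ?andbF.
  by move=> s Bs; rewrite mem_of_sizes Bs type_of_qperm /=.
have [<- _] := multinomial_mul (type_of_sizes D).
have := count setT; rewrite (_ : [set s | _] = setT) => [|]; last first.
  by apply/setP => s; rewrite !inE.
by rewrite cardsT card_Sn => ->; rewrite count -mulnA [(N * _)%N]mulnC.
Qed.

(** * Splitting weights that are powers of d *)

Local Open Scope nat_scope.

(* Adding the elements by decreasing weight fills the blocks of size M one after
   the other, because the remaining room is a multiple of the next weight. *)
Lemma chain_blocks (T : finType) (w : T -> nat) (M : nat) (S : {set T}) : 0 < M ->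
  {in S &, forall x y, w x <= w y -> w x %| w y} ->
  {in S, forall x, 0 < w x /\ w x %| M} ->
  exists g : T -> nat, forall j,
    \sum_(x in S | g x == j) w x = minn M (\sum_(x in S) w x - j * M).
Proof.
move=> M_gt0; have [m cS] : exists m, #|S| <= m by exists #|S|.
elim: m S cS => [|m IHm] S cS chain dvdM.
  move: cS; rewrite leqn0 cards_eq0 => /eqP->.
  by exists (fun=> 0) => j; rewrite big_set0 sub0n minn0 big_pred0 // => x; rewrite inE.
have [->|[z0 z0S]] := set_0Vmem S.
  by exists (fun=> 0) => j; rewrite big_set0 sub0n minn0 big_pred0 // => x; rewrite inE.
have [z zS zmin] := arg_minnP w z0S.
have zS' : z \in S by [].
pose S' := S :\ z.
have sS' : {subset S' <= S} by move=> x /setD1P[].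
have cS' : #|S'| <= m by move: cS; rewrite (cardsD1 z) zS'.
have [||g gE] := IHm S' cS'.
- by move=> x y /sS' xS /sS' yS; apply: chain.
- by move=> x /sS' /dvdM.
pose s := \sum_(x in S') w x.
have [wz_gt0 wzM] := dvdM z zS'.
have wzs : w z %| s.
  by apply: dvdn_sum => x /sS' xS; apply: chain => //; apply: zmin.
have sE : \sum_(x in S) w x = w z + s by rewrite (big_setD1 z).
(* Blocks before [s %/ M] are already full and later ones empty, so the lightest element [z], added
   last, goes into this one. *)
exists (fun x => if x == z then s %/ M else g x) => j.
have -> : \sum_(x in S | (if x == z then s %/ M else g x) == j) w x =
    (if s %/ M == j then w z else 0) + minn M (s - j * M).
  rewrite -gE !big_mkcondr /= (big_setD1 z) //= eqxx; congr (_ + _).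
  by apply: eq_bigr => x /setD1P[/negPf-> _].
rewrite sE.
have room : w z + s %% M <= M.
  have /dvdnP[q Mq] := wzM; have /dvdnP[r sr] : w z %| s %% M.
    by rewrite -(dvdn_addr _ (dvdn_mull (s %/ M) wzM)) -divn_eq.
  have := ltn_pmod s M_gt0; rewrite sr => rM.
  have: r < q by rewrite -(ltn_pmul2r wz_gt0) -Mq.
  by rewrite -mulSn [X in _ -> _ <= X]Mq leq_mul2r orbC => ->.
have := divn_eq s M; set q := s %/ M; set r := s %% M => ->.
case: eqP => [<-|]; nia.
Qed.

(** The Kraft sum of [l] over [S], scaled by [d ^ L] to stay among integers. The subtraction
    truncates, so this reading needs [l x <= L] on [S]. *)
Definition wsum (d n : nat) (S : {set 'I_n}) (l : 'I_n -> nat) (L : nat) : nat :=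
  \sum_(x in S) d ^ (L - l x).

Lemma wsum_parts (d n : nat) (D : question d n) S l L :
  wsum d S l L = \sum_(j < d) wsum d (S :&: part D j) l L.
Proof.
rewrite /wsum (partition_big D predT) //=; apply: eq_bigr => j _.
by apply: eq_bigl => x; rewrite !inE.
Qed.

Lemma wsum_subset (d n : nat) (A B : {set 'I_n}) l L :
  A \subset B -> wsum d A l L <= wsum d B l L.
Proof.
by move=> AB; rewrite /wsum [X in _ <= X](big_setID A) /= (setIidPr AB) leq_addr.
Qed.

Lemma wsum_pred (d n : nat) (S : {set 'I_n}) l L :
  {in S, forall x, 0 < l x} -> wsum d S (fun x => (l x).-1) L = wsum d S l L.+1.
Proof.
by move=> l_gt0; apply: eq_bigr => x /l_gt0; case: (l x).
Qed.

(** With blocks of size [d ^ L] in [chain_blocks], the total is exactly [d] blocks, so the first [d]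
    are full and later ones empty. *)
Lemma split_set (d n L : nat) (S : {set 'I_n}) l : 1 < d ->
  {in S, forall x, 0 < l x <= L.+1} -> wsum d S l L.+1 = d ^ L.+1 ->
  exists D : question d n, forall j, wsum d (S :&: part D j) l L.+1 = d ^ L.
Proof.
move=> d_gt1 Sl sumS; have d_gt0 : 0 < d by lia.
have [|||g gE] := @chain_blocks _ (fun x => d ^ (L.+1 - l x)) (d ^ L) S.
- by rewrite expn_gt0 d_gt0.
- by move=> x y xS yS /=; rewrite leq_exp2l // => /dvdn_exp2l->.
- move=> x /Sl /andP[lx _]; rewrite expn_gt0 d_gt0; split=> //.
  by apply: dvdn_exp2l; lia.
have g_lt x : x \in S -> g x < d.
  move=> xS; rewrite ltnNge; apply/negP => le_dg.
  have := gE (g x); rewrite (bigD1 x) ?xS ?eqxx //= -/(wsum d S l L.+1) sumS expnS.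
  have : 0 < d ^ (L.+1 - l x) by rewrite expn_gt0 d_gt0.
  have : d * d ^ L <= g x * d ^ L by rewrite leq_mul2r le_dg orbT.
  lia.
exists [ffun x => insubd (Ordinal d_gt0) (g x)] => j.
rewrite /wsum; under eq_bigl => x do rewrite !inE ffunE.
have := gE j; rewrite -/(wsum d S l L.+1) sumS.
have -> : minn (d ^ L) (d ^ L.+1 - j * d ^ L) = d ^ L.
  rewrite expnS -mulnBl; apply/minn_idPl; rewrite leq_pmull //.
  by rewrite subn_gt0.
move=> <-; apply: eq_bigl => x; case: (boolP (x \in S)) => //= xS.
by rewrite -val_eqE /= val_insubd g_lt.
Qed.

Lemma wsum_zero (d n L : nat) (S : {set 'I_n}) l x : 0 < d ->
  x \in S -> l x = 0 -> wsum d S l L <= d ^ L -> S = [set x].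
Proof.
move=> d_gt0 xS lx; rewrite /wsum (big_setD1 x) //= lx subn0.
rewrite -[X in _ <= X]addn0 leq_add2l leqn0 sum_nat_eq0 => /forallP S0.
apply/setP => y; rewrite inE; apply/idP/eqP => [yS|-> //].
apply/eqP; apply/negPn/negP => yx.
have := S0 y; rewrite !inE yx yS /= expn_eq0; lia.
Qed.

(** Induction on [L]: after an even split all [d >= 2] parts are nonempty, so passing to the part of
    [x] loses an element as well as a level. *)
Lemma depth_lt_card (d n L : nat) (S : {set 'I_n}) l x : 1 < d ->
  {in S, forall x, l x <= L} -> wsum d S l L = d ^ L -> x \in S -> l x < #|S|.
Proof.
move=> d_gt1; elim: L S l x => [|L IHL] S l x Sl sumS xS.
  by move: (Sl x xS); rewrite leqn0 => /eqP->; rewrite card_gt0; apply/set0Pn; exists x.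
have d_gt0 : 0 < d by lia.
have [/existsP[y /andP[yS /eqP ly]]|] := boolP [exists y in S, l y == 0].
  have SE := wsum_zero d_gt0 yS ly (eq_leq sumS).
  by move: xS; rewrite SE cards1 inE => /eqP ->; rewrite ly.
rewrite negb_exists_in => /forall_inP l_neq0.
have l_gt0 y : y \in S -> 0 < l y by move/l_neq0; rewrite lt0n.
have [|//|D DE] := @split_set d n L S l d_gt1.
  by move=> y yS; rewrite l_gt0 ?Sl.
pose P j := S :&: part D j.
have xP : x \in P (D x) by rewrite !inE xS eqxx.
have : (l x).-1 < #|P (D x)|.
  apply: (IHL _ (fun x => (l x).-1)) => //.
    by move=> y /setIP[yS _]; have := Sl y yS; lia.
  by rewrite wsum_pred ?DE // => y /setIP[/l_gt0].
have [j jD] : exists j, j != D x.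
  have [e0 e1] : 0 < d /\ 1 < d by [].
  have [<-|] := eqVneq (Ordinal e0) (D x); last by exists (Ordinal e0).
  by exists (Ordinal e1).
have Pj : 0 < #|P j|.
  rewrite card_gt0; apply/negP => /eqP Pj0.
  have := DE j; rewrite -/(P j) Pj0 /wsum big_set0.
  have : 0 < d ^ L by rewrite expn_gt0 d_gt0.
  lia.
have dis : [disjoint P j & P (D x)].
  rewrite -setI_eq0; apply/eqP/setP => y; rewrite !inE.
  by have [->|] := eqVneq (D y) j; rewrite ?(negPf jD) ?andbF.
have : #|P j :|: P (D x)| <= #|S|.
  by apply: subset_leq_card; apply/subsetP => y; rewrite !inE => /orP[]/andP[].
rewrite cardsU (disjoint_setI0 dis) cards0 => ?.
by have := l_gt0 x xS; lia.
Qed.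

(** * Hitting sets and the slack of unlabeled leaves *)

(** Integer form of meeting every [Div mu]: non-constant d-adic distributions are the codes with
    positive depths and Kraft sum 1, and scaled part sums [d ^ L] are masses [1/d]. *)
Definition hitting (d n : nat) (Q : {set question d n}) : Prop :=
  forall (S : {set 'I_n}) l L, {in S, forall x, 0 < l x <= L.+1} ->
  wsum d S l L.+1 = d ^ L.+1 ->
  exists2 D, D \in Q & forall j, wsum d (S :&: part D j) l L.+1 = d ^ L.

(* The slack d - 2 accounts for the unlabeled leaves of an optimal tree. *)
Definition splitting (d n : nat) (Q : {set question d n}) : Prop :=
  forall (S : {set 'I_n}) l L, {in S, forall x, 0 < l x <= L.+1} ->
  d ^ L.+1 <= wsum d S l L.+1 + (d - 2) -> wsum d S l L.+1 <= d ^ L.+1 ->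
  exists2 D, D \in Q & forall j, wsum d (S :&: part D j) l L.+1 <= d ^ L.

(** Since [g] may repeat values, its image can be any nonempty set of at most [d - 2] elements when
    [d > 2]. *)
Definition gather (d n : nat) (D : question d n) (y : 'I_n)
    (g : {ffun 'I_(d - 2) -> 'I_n}) : question d n :=
  [ffun x => if x \in codom g then D y else D x].

Definition gathered (d n : nat) (Q : {set question d n}) : {set question d n} :=
  [set gather p.1 p.2.1 p.2.2 | p in setX Q setT].

Lemma card_gathered (d n : nat) (Q : {set question d n}) :
  #|gathered Q| <= n * n ^ (d - 2) * #|Q|.
Proof.
apply: leq_trans (leq_imset_card _ _) _.
by rewrite cardsX cardsT card_prod card_ffun !card_ord mulnC.
Qed.

Lemma mem_gathered (d n : nat) (Q : {set question d n}) D y g :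
  D \in Q -> gather D y g \in gathered Q.
Proof. by move=> DQ; apply/imsetP; exists (D, (y, g)); rewrite // !inE DQ. Qed.

Lemma sub_gathered (d n : nat) (Q : {set question d n}) :
  0 < n -> Q \subset gathered Q.
Proof.
move=> n_gt0; apply/subsetP => D DQ; pose y := Ordinal n_gt0.
rewrite (_ : D = gather D y [ffun=> y]) ?mem_gathered //.
by apply/ffunP => x; rewrite ffunE; case: codomP => // -[i ->]; rewrite ffunE.
Qed.

Lemma subset_of_card (T : finType) (A : {set T}) k : k <= #|A| ->
  exists2 B : {set T}, B \subset A & #|B| = k.
Proof.
move=> le_k; exists [set x in take k (enum A)].
  by apply/subsetP => x; rewrite inE => /mem_take; rewrite mem_enum.
rewrite cardsE (card_uniqP _) ?take_uniq ?enum_uniq // size_take -cardE.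
by case: ltngtP le_k.
Qed.

Lemma wsum_disjoint (d n : nat) (A S : {set 'I_n}) l L : A \subset S ->
  wsum d S l L = wsum d A l L + wsum d (S :\: A) l L.
Proof. by move=> AS; rewrite /wsum (big_setID A) /= (setIidPr AS). Qed.

Lemma wsum_const (d n : nat) (A : {set 'I_n}) l L c :
  {in A, forall x, l x = c} -> wsum d A l L = #|A| * d ^ (L - c).
Proof.
by move=> Al; rewrite /wsum -sum_nat_const; apply: eq_bigr => x /Al ->.
Qed.

(* If the weights of S fall short of 1 by e units of the lowest level, then the
   number of elements of S on that level is -e mod d, so some d - e of them can
   be replaced by a single element y one level higher; a question that splits
   the resulting weights evenly then only has to be made to answer alike on the
   d - e elements. *)
Lemma splitting_gathered (d n : nat) (Q : {set question d n}) :
  1 < d -> d <= n -> hitting Q -> splitting (gathered Q).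
Proof.
move=> d_gt1 le_dn hitQ S l L Sl lb ub.
have n_gt0 : 0 < n by lia.
have sQ := subsetP (sub_gathered Q n_gt0).
have [e0|e_neq0] := eqVneq (wsum d S l L.+1) (d ^ L.+1).
  have [D DQ DE] := hitQ S l L Sl e0.
  by exists D => [|j]; rewrite ?sQ ?DE.
pose e := d ^ L.+1 - wsum d S l L.+1.
have sumE : wsum d S l L.+1 + e = d ^ L.+1 by rewrite subnKC.
have e_gt0 : 0 < e by rewrite subn_gt0 ltn_neqAle e_neq0.
have e_le : e <= d - 2 by rewrite leq_subLR.
pose C := [set x in S | l x == L.+1].
have CS : C \subset S by apply/subsetP => x; rewrite inE => /andP[].
(* Weights above the lowest level are multiples of [d], so [d] divides [#|C| + e], which is
   positive. *)
have cC : d - e <= #|C|.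
  have dvd_rest : d %| wsum d (S :\: C) l L.+1.
    apply: dvdn_sum => x; rewrite !inE => /andP[xC xS].
    move: xC; rewrite xS /= => xL; have := Sl x xS => lx.
    by rewrite -{1}(expn1 d) dvdn_exp2l //; move/eqP: xL => xL; lia.
  have : d %| #|C| + e.
    rewrite -(dvdn_addl _ dvd_rest) addnAC -[X in X + _ + _]muln1.
    rewrite -[X in _ * X + _ + _](expn0 d) -(subnn L.+1).
    rewrite -(@wsum_const d n C l) => [|x]; last by rewrite inE => /andP[_ /eqP].
    by rewrite -wsum_disjoint // sumE expnS dvdn_mulr.
  by move/dvdn_leq => /(_ (ltn_addl _ e_gt0)); lia.
(* With [L = 0] all depths are 1 and [y] could not move up and keep a positive depth; instead [S] is
   padded to [d] elements of depth 1, using [d <= n]. *)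
case: L => [|L] in Sl lb ub e_neq0 @e sumE e_gt0 e_le @C CS cC *.
  have Sl1 : {in S, forall x, l x = 1} by move=> x /Sl; lia.
  have sumS : wsum d S l 1 = #|S| by rewrite (wsum_const _ _ Sl1) subnn muln1.
  have [B BS cB] : exists2 B : {set 'I_n}, S \subset B & #|B| = d.
    have [|B BS cB] := @subset_of_card _ (~: S) (d - #|S|).
      by have := cardsC S; rewrite card_ord; lia.
    exists (S :|: B); rewrite ?subsetUl // cardsU.
    have -> : S :&: B = set0.
      by apply/eqP; rewrite setIC setI_eq0 disjoints_subset.
    by rewrite cards0 cB; move: ub; rewrite sumS expn1; lia.
  have [||D DQ DE] := hitQ B (fun=> 1) 0 => //.
    by rewrite (@wsum_const _ _ _ _ _ 1) // cB expn1 muln1.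
  exists D => [|j]; first exact: sQ.
  rewrite -(DE j); apply: leq_trans (wsum_subset _ _ _ (setSI _ BS)).
  by apply: eq_leq; apply: eq_bigr => x /setIP[/Sl1->].
have [A AC cA] := subset_of_card cC.
have AS := subset_trans AC CS.
have Al : {in A, forall x, l x = L.+2}.
  by move=> x /(subsetP AC); rewrite inE => /andP[_ /eqP].
have [y yA] : exists y, y \in A by apply/set0Pn; rewrite -card_gt0; lia.
(* Trading the [d - e] units of [A] for the weight [d] of [y] adds exactly the missing [e]. *)
pose l' x := if x == y then L.+1 else l x.
pose S' := y |: (S :\: A).
have yS' : y \notin S :\: A by rewrite inE yA.
have l'E : {in S :\: A, l' =1 l}.
  by move=> x xS; rewrite /l'; case: eqP xS => // ->; rewrite (negPf yS').
have sub' (D : question d n) j : wsum d (S' :&: part D j) l' L.+2 =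
    (j == D y) * d + wsum d ((S :\: A) :&: part D j) l L.+2.
  rewrite setIUl; have -> : [set y] :&: part D j = if j == D y then [set y] else set0.
    apply/setP => x; rewrite !inE; case: (eqVneq x y) => [->|xy] /=.
      by rewrite eq_sym; case: eqP; rewrite inE ?eqxx.
    by case: eqP; rewrite inE ?(negPf xy).
  have -> : wsum d ((S :\: A) :&: part D j) l L.+2 =
      wsum d ((S :\: A) :&: part D j) l' L.+2.
    by apply: eq_bigr => x /setIP[/l'E ->].
  case: eqP => _; last by rewrite set0U.
  rewrite (@wsum_disjoint _ _ [set y]) ?subsetUl // setU1K ?inE ?yA //.
  by rewrite /wsum big_set1 /l' eqxx subSn // subnn expn1 mul1n.
have sumA : wsum d A l L.+2 = d - e by rewrite (wsum_const _ _ Al) subnn muln1.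
have sumE2 := @wsum_disjoint d n A S l L.+2 AS; rewrite sumA in sumE2.
have [||D DQ DE] := hitQ S' l' L.+1.
- move=> x /setU1P[->|xS]; first by rewrite /l' eqxx; lia.
  by rewrite l'E //; apply: Sl; case/setDP: xS.
- rewrite (wsum_disjoint _ _ _ (A := [set y])) ?subsetUl // setU1K //.
  rewrite {1}/wsum big_set1 {1}/l' eqxx subSn // subnn expn1.
  have -> : wsum d (S :\: A) l' L.+2 = wsum d (S :\: A) l L.+2.
    by apply: eq_bigr => x /l'E ->.
  lia.
pose r := enum (A :\ y).
have size_r : size r <= d - 2.
  by rewrite -cardE; move: cA; rewrite (cardsD1 y) yA; lia.
(* The default [y] of [nth] fills the indices beyond [r]; this is harmless, since [y] keeps its
   answer. *)
pose g : {ffun 'I_(d - 2) -> 'I_n} := [ffun i : 'I_(d - 2) => nth y r i].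
have gA x : (D x != D y) -> (x \in codom g) = (x \in A) && (x != y).
  move=> Dxy; have xy : x != y by apply: contraNneq Dxy => ->.
  rewrite xy andbT; apply/codomP/idP => [[i]|xA].
    rewrite ffunE; have [lt_i xE|ge_i] := ltnP i (size r).
      have : x \in r by rewrite xE mem_nth.
      by rewrite mem_enum => /setD1P[].
    by rewrite nth_default // => xE; rewrite xE eqxx in xy.
  have xr : x \in r by rewrite mem_enum !inE xy.
  have lt_i : index x r < d - 2 by rewrite (leq_trans _ size_r) // index_mem.
  by exists (Ordinal lt_i); rewrite ffunE /= nth_index.
pose D' := gather D y g.
have D'E x : D' x = if x \in A then D y else D x.
  rewrite ffunE; have [->|Dxy] := eqVneq (D x) (D y); first by rewrite !if_same.
  rewrite gA //; case: (x \in A) => //=.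
  by case: eqP => [->|].
exists D' => [|j]; first exact: mem_gathered.
rewrite -(DE j) sub' (@wsum_disjoint _ _ (A :&: part D' j)) ?setSI //.
apply: leq_add.
  have [->|jD] := eqVneq j (D y).
    rewrite mul1n; apply: leq_trans (wsum_subset _ _ _ (subsetIl _ _)) _.
    by rewrite sumA; lia.
  rewrite (_ : A :&: _ = set0) ?[wsum _ _ _ _]big_set0 //; apply/setP => x.
  by rewrite !inE D'E; case: (x \in A) => //=; rewrite eq_sym (negPf jD).
apply: wsum_subset; apply/subsetP => x; rewrite !inE D'E.
by case: (x \in A) => /= [/and3P[/negPf->]|] //; case: (x \in S).
Qed.

Lemma hitting_setT (d n : nat) : 1 < d -> hitting [set: question d n].
Proof.
move=> d_gt1 S l L Sl sumS; have [D DE] := split_set d_gt1 Sl sumS.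
by exists D.
Qed.

Lemma splitting_setT (d n : nat) : 1 < d -> d <= n -> splitting [set: question d n].
Proof.
move=> d_gt1 le_dn S l L Sl lb ub.
have [D _ DE] := splitting_gathered d_gt1 le_dn (hitting_setT d_gt1) Sl lb ub.
by exists D.
Qed.

(** * Search trees and Kraft sums *)

Lemma labels_Node (d n : nat) (D : question d n) c :
  labels (Node D c) = flatten [seq labels (c j) | j <- enum 'I_d].
Proof.
rewrite /labels /= map_flatten -map_comp; congr flatten; apply: eq_map => j.
by rewrite /= -map_comp.
Qed.

Lemma count_labels_Node (d n : nat) (D : question d n) c x :
  count_mem x (labels (Node D c)) = \sum_j count_mem x (labels (c j)).
Proof.
by rewrite labels_Node count_flatten sumnE !big_map -?enumT ?big_enum.
Qed.

Lemma mem_labels_Node (d n : nat) (D : question d n) c x :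
  consistent (Node D c) -> (x \in labels (Node D c)) = (x \in labels (c (D x))).
Proof.
move=> cons; rewrite labels_Node; apply/flatten_mapP/idP => [[j _ xj]|xD].
  by have [_ /(_ x xj)] := cons j; rewrite inE => /eqP->.
by exists (D x); rewrite ?mem_enum.
Qed.

Lemma count_labels_consistent (d n : nat) (D : question d n) c x :
  consistent (Node D c) ->
  count_mem x (labels (Node D c)) = count_mem x (labels (c (D x))).
Proof.
move=> cons; rewrite count_labels_Node (bigD1 (D x)) //= big1 ?addn0 // => j jD.
apply/eqP; rewrite -leqn0 leqNgt -has_count has_pred1; apply/negP => xj.
by have [_ /(_ x xj)] := cons j; rewrite inE eq_sym (negPf jD).
Qed.

Lemma uniq_count_le1 (T : eqType) (s : seq T) :
  uniq s <-> forall x, count_mem x s <= 1.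
Proof.
split=> [us x|le1]; first by rewrite count_uniq_mem // leq_b1.
apply: count_mem_uniq => x; have := le1 x; rewrite -has_pred1 has_count.
by case: (count_mem x s) => // -[].
Qed.

Lemma uniq_labels_Node (d n : nat) (D : question d n) c :
  consistent (Node D c) ->
  (uniq (labels (Node D c)) <-> forall j, uniq (labels (c j))).
Proof.
move=> cons; split=> [/uniq_count_le1 u j|u].
  apply/uniq_count_le1 => x; apply: leq_trans (u x).
  by rewrite count_labels_Node (bigD1 j) //= leq_addr.
apply/uniq_count_le1 => x; rewrite count_labels_consistent //.
by have /uniq_count_le1 := u (D x).
Qed.

Lemma depth_Node (d n : nat) (D : question d n) c x :
  consistent (Node D c) -> uniq (labels (Node D c)) ->
  x \in labels (Node D c) -> depth (Node D c) x = (depth (c (D x)) x).+1.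
Proof.
move=> cons u xt; have /(uniq_labels_Node cons) uc := u.
have sumS j : \sum_(p <- leaves (c j) | p.1 == x) p.2.+1 =
    depth (c j) x + count_mem x (labels (c j)).
  rewrite (eq_bigr (fun p => p.2 + 1)) => [|p _]; last by rewrite addn1.
  by rewrite big_split /= count_map -sum1_count.
rewrite /depth /= big_flatten /= big_map big_enum /=.
under eq_bigr => j _ do rewrite big_map /= sumS.
rewrite (bigD1 (D x)) //= count_uniq_mem // -(mem_labels_Node x cons) xt addn1.
rewrite big1 ?addn0 // => j jD.
have xj : x \notin labels (c j).
  by apply/negP => xj; have [_ /(_ x xj)] := cons j; rewrite inE eq_sym (negPf jD).
rewrite count_uniq_mem // (negPf xj) addn0.
rewrite /depth big_seq_cond big1 // => p /andP[pj /eqP px].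
by case/negP: xj; rewrite -px map_f.
Qed.

(** Converse of Kraft's inequality for questions in [Q]: split at the root and recurse with depths
    lowered by one. *)
Lemma tree_of_depths (d n : nat) (Q : {set question d n}) : splitting Q ->
  forall L (S : {set 'I_n}) l, 0 < d -> {in S, forall x, l x <= L} ->
  d ^ L <= wsum d S l L + (d - 2) -> wsum d S l L <= d ^ L ->
  exists t : tree d n, [/\ search_tree t, labels t =i S, uses Q t &
    {in S, forall x, depth t x = l x}].
Proof.
move=> splitQ; elim=> [|L IHL] S l d_gt0 Sl lb ub.
  have [S0|[x xS]] := set_0Vmem S.
    (* An unlabeled leaf: for [d > 2] the empty set satisfies both bounds at level 0. *)
    by exists (Leaf None); split=> // x; rewrite S0 !inE.
  have lx : l x = 0 by apply/eqP; rewrite -leqn0 Sl.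
  exists (Leaf (Some x)); rewrite (wsum_zero d_gt0 xS lx ub).
  split=> // y; rewrite ?inE // => /eqP->.
  by rewrite lx /depth /= big_cons big_nil eqxx.
have [/existsP[x /andP[xS /eqP lx]]|] := boolP [exists y in S, l y == 0].
  exists (Leaf (Some x)); rewrite (wsum_zero d_gt0 xS lx ub).
  split=> // y; rewrite ?inE // => /eqP->.
  by rewrite lx /depth /= big_cons big_nil eqxx.
rewrite negb_exists_in => /forall_inP l_neq0.
have l_gt0 y : y \in S -> 0 < l y by move/l_neq0; rewrite lt0n.
have [|//|//|D DQ DE] := splitQ S l L.
  by move=> y yS; rewrite l_gt0 ?Sl.
have l_gt0j j : {in S :&: part D j, forall x, 0 < l x} by move=> x /setIP[/l_gt0].
have sub j : exists t : tree d n, [/\ search_tree t, labels t =i S :&: part D j,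
    uses Q t & {in S :&: part D j, forall x, depth t x = (l x).-1}].
  apply: IHL => //.
  - by move=> x /setIP[/Sl lx _]; lia.
  (* The other [d - 1] parts hold at most [d ^ L] each, so the deficit of part [j] is at most the
     total deficit. *)
  - rewrite wsum_pred //; move: lb; rewrite (wsum_parts D) (bigD1 j) //=.
    have : \sum_(i < d | i != j) wsum d (S :&: part D i) l L.+1 <= (d - 1) * d ^ L.
      apply: leq_trans (leq_sum _ (fun i _ => DE i)) _.
      rewrite sum_nat_const leq_mul2r; apply/orP; right.
      by rewrite cardC1 card_ord subn1.
    have -> : d ^ L.+1 = d ^ L + (d - 1) * d ^ L.
      by rewrite -mulSn expnS; congr (_ * _); lia.
    by move: (\sum_(i < d | _) _) (wsum _ _ _ _) ((d - 1) * _) => r w m; lia.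
  - by rewrite wsum_pred.
have [c cE] := fin_all_exists sub.
have cons : consistent (Node D c).
  move=> j; have [[? _] lab _ _] := cE j; split=> // x.
  by rewrite lab => /setIP[].
have lab : labels (Node D c) =i S.
  move=> x; rewrite mem_labels_Node //; have [_ -> _ _] := cE (D x).
  by rewrite !inE eqxx andbT.
have u : uniq (labels (Node D c)).
  by apply/uniq_labels_Node => // j; have [[]] := cE j.
exists (Node D c); split=> //.
  by split=> // j; have [] := cE j.
move=> x xS; rewrite depth_Node ?lab //; have [_ _ _ ->] := cE (D x).
  by rewrite prednK // l_gt0.
by rewrite !inE xS eqxx.
Qed.

Local Open Scope ring_scope.

Definition kraft (R : realType) (d n : nat) (S : {set 'I_n}) (l : 'I_n -> nat) : R :=
  \sum_(x in S) d%:R ^- l x.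

Lemma wsumE (R : realType) (d n L : nat) (S : {set 'I_n}) l : (0 < d)%N ->
  {in S, forall x, (l x <= L)%N} ->
  (wsum d S l L)%:R = d%:R ^+ L * kraft R d S l.
Proof.
move=> d_gt0 Sl; rewrite /wsum /kraft natr_sum mulr_sumr.
apply: eq_bigr => x /Sl lx; rewrite natrX exprB //.
by rewrite unitfE pnatr_eq0 -lt0n.
Qed.

Lemma kraft_parts (R : realType) (d n : nat) (D : question d n) S l :
  kraft R d S l = \sum_j kraft R d (S :&: part D j) l.
Proof.
rewrite /kraft (partition_big D predT) //=; apply: eq_bigr => j _.
by apply: eq_bigl => x; rewrite !inE.
Qed.

Lemma kraft_Node (R : realType) (d n : nat) (D : question d n) c
    (S : {set 'I_n}) j :
  search_tree (Node D c) -> {subset S <= labels (Node D c)} ->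
  kraft R d (S :&: part D j) (depth (Node D c)) =
    d%:R^-1 * kraft R d (S :&: part D j) (depth (c j)).
Proof.
move=> [cons u] sub; rewrite /kraft mulr_sumr; apply: eq_bigr => x.
by rewrite !inE => /andP[xS /eqP xj]; rewrite depth_Node ?sub // xj exprS invfM.
Qed.

Lemma search_tree_child (d n : nat) (D : question d n) c (S : {set 'I_n}) j :
  search_tree (Node D c) -> {subset S <= labels (Node D c)} ->
  search_tree (c j) /\ {subset S :&: part D j <= labels (c j)}.
Proof.
move=> [cons u] sub; have /(uniq_labels_Node cons) uc := u; split.
  by split; [have [] := cons j | exact: uc].
move=> x; rewrite !inE => /andP[/sub xS /eqP <-].
by rewrite mem_labels_Node in xS.
Qed.

(** Kraft's inequality, by induction on the tree: each of the [d] children contributes at most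
    [1/d]. Allowing any set [S] of labels lets the induction pass to its parts. *)
Lemma kraft_tree (R : realType) (d n : nat) (t : tree d n) (S : {set 'I_n}) :
  (0 < d)%N -> search_tree t -> {subset S <= labels t} ->
  kraft R d S (depth t) <= 1.
Proof.
move=> d_gt0; elim: t S => [[x|]|D c IH] S.
- move=> _ sub; have : S \subset [set x] by apply/subsetP => y /sub; rewrite !inE.
  rewrite subset1 /kraft => /orP[]/eqP->; last by rewrite big_set0 ler01.
  by rewrite big_set1 /depth /= big_cons big_nil eqxx expr0 invr1.
- by move=> _ sub; rewrite /kraft big1 ?ler01 // => x /sub.
move=> tree_t sub; rewrite (kraft_parts _ D).
apply: (@le_trans _ _ (\sum_(j < d) d%:R^-1)); last first.
  by rewrite sumr_const card_ord -[X in X <= _]mulr_natl mulfV // pnatr_eq0 -lt0n.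
apply: ler_sum => j _; rewrite kraft_Node // ler_piMr ?invr_ge0 ?ler0n //.
by have [tree_c sub_c] := search_tree_child j tree_t sub; apply: IH.
Qed.

Lemma kraft_tree_part (R : realType) (d n : nat) (D : question d n) c
    (S : {set 'I_n}) j :
  (0 < d)%N -> search_tree (Node D c) -> {subset S <= labels (Node D c)} ->
  kraft R d (S :&: part D j) (depth (Node D c)) <= d%:R^-1.
Proof.
move=> d_gt0 tree_t sub; rewrite kraft_Node // ler_piMr ?invr_ge0 ?ler0n //.
by have [tree_c sub_c] := search_tree_child j tree_t sub; apply: kraft_tree.
Qed.

(** * Optimal sets of questions *)

(** Constant depth [n] is admissible and costs [n], and a depth above [B] anywhere on the support
    costs at least that much, so a search among finitely many depth functions suffices. *)
Lemma kraft_minimizer (R : realType) (d n : nat) (p : 'I_n -> R) :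
  (1 < d)%N -> distribution p ->
  exists l : 'I_n -> nat, kraft R d (Defs.support p) l <= 1 /\
    forall l2 : 'I_n -> nat, kraft R d (Defs.support p) l2 <= 1 ->
    \sum_x p x * (l x)%:R <= \sum_x p x * (l2 x)%:R.
Proof.
move=> d_gt1 [p_ge0 sum_p]; set S := Defs.support p.
have d_gt0 : (0 < d)%N by lia.
have S_gt0 x : x \in S -> 0 < p x.
  by rewrite inE lt_neqAle eq_sym => ->; exact: p_ge0.
have [B BS] : exists B, forall x, x \in S -> n%:R <= p x * B%:R.
  exists (\max_(x in S) (Num.truncn (n%:R / p x)).+1)%N => x xS.
  rewrite -ler_pdivrMl ?S_gt0 // mulrC; apply: le_trans (ltW (truncnS_gt _)) _.
  by rewrite ler_nat;
     exact: (@leq_bigmax_cond _ (mem S) (fun x => (Num.truncn (n%:R / p x)).+1)).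
pose M := maxn n B.
have kn : kraft R d S (fun=> n) <= 1.
  rewrite /kraft sumr_const -[X in X <= _]mulr_natl ler_pdivrMr ?exprn_gt0 ?ltr0n //.
  rewrite mul1r -natrX ler_nat; apply: leq_trans (ltnW (ltn_expl n d_gt1)).
  by rewrite -[X in (_ <= X)%N]card_ord max_card.
pose C (f : {ffun 'I_n -> 'I_M.+1}) : R := \sum_x p x * (f x)%:R.
pose K (f : {ffun 'I_n -> 'I_M.+1}) := kraft R d S (fun x => f x : nat) <= 1.
have kraftE (l1 l2 : 'I_n -> nat) : {in S, l1 =1 l2} -> kraft R d S l1 = kraft R d S l2.
  by move=> e; apply: eq_bigr => x xS; rewrite e.
pose f0 : {ffun 'I_n -> 'I_M.+1} := [ffun=> inord n].
have nM : (n < M.+1)%N by rewrite ltnS leq_maxl.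
have Kf0 : K f0.
  by rewrite /K (@kraftE _ (fun=> n)) // => x _; rewrite ffunE inordK.
have Cf0 : C f0 = n%:R.
  rewrite /C -[RHS]mul1r -sum_p mulr_suml; apply: eq_bigr => x _.
  by rewrite ffunE inordK.
case: (arg_minP C Kf0) => f Kf f_min.
exists (fun x => f x : nat); split=> // l2 Kl2; rewrite -/(C f).
have [/forall_inP l2M|] := boolP [forall (x | x \in S), (l2 x <= M)%N].
  pose f2 : {ffun 'I_n -> 'I_M.+1} := [ffun x => inord (l2 x)].
  have f2E x : x \in S -> f2 x = l2 x :> nat.
    by move=> xS; rewrite ffunE inordK // ltnS l2M.
  have := f_min f2; rewrite /K (kraftE _ _ f2E) => /(_ Kl2).
  move/le_trans; apply; rewrite le_eqVlt; apply/orP; left; apply/eqP.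
  apply: eq_bigr => x _; have [xS|] := boolP (x \in S); first by rewrite f2E.
  by rewrite inE negbK => /eqP->; rewrite !mul0r.
rewrite negb_forall_in => /exists_inP[x xS]; rewrite -ltnNge => lx.
apply: le_trans (f_min f0 Kf0) _; rewrite Cf0.
apply: le_trans (BS x xS) _; apply: (@le_trans _ _ (p x * (l2 x)%:R)).
  by rewrite ler_wpM2l // ler_nat; apply: leq_trans (ltnW lx); exact: leq_maxr.
by rewrite (bigD1 x) //= lerDl; apply: sumr_ge0 => y _; rewrite mulr_ge0.
Qed.

Lemma cost_on_support (R : realType) (d n : nat) (p : 'I_n -> R) (t : tree d n) l :
  {in Defs.support p, depth t =1 l} -> cost p t = \sum_x p x * (l x)%:R.
Proof.
move=> tl; apply: eq_bigr => x _; have [/tl-> //|] := boolP (x \in Defs.support p).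
by rewrite inE negbK => /eqP->; rewrite !mul0r.
Qed.

(** A Kraft-optimal [l] has slack at most [d - 2], otherwise a deepest element could move up one
    level. Hence some tree using [Q] realizes [l], and Kraft's inequality shows that no valid tree
    is cheaper. *)
Lemma splitting_optimal (R : realType) (d n : nat) (Q : {set question d n}) :
  (1 < d)%N -> splitting Q -> optimal R Q.
Proof.
move=> d_gt1 splitQ p p_dist; have d_gt0 : (0 < d)%N by lia.
have [l [kl l_min]] := kraft_minimizer d_gt1 p_dist.
have [p_ge0 sum_p] := p_dist; set S := Defs.support p in kl l_min.
have [z0 z0S] : exists z, z \in S.
  apply/existsP; apply: contraT; rewrite negb_exists => /forallP S0.
  have := oner_neq0 R; rewrite -sum_p big1 ?eqxx // => x _.
  by have := S0 x; rewrite inE negbK => /eqP.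
pose L := (\max_(x in S) l x)%N.
have SL : {in S, forall x, (l x <= L)%N} by move=> x xS; exact: leq_bigmax_cond.
have kraft_le (l2 : 'I_n -> nat) : {in S, forall x, (l2 x <= L)%N} ->
    (kraft R d S l2 <= 1) = (wsum d S l2 L <= d ^ L)%N.
  move=> l2L; rewrite -(ler_nat R) wsumE // natrX ger_pMr //.
  by rewrite exprn_gt0 // ltr0n.
have ub : (wsum d S l L <= d ^ L)%N by rewrite -kraft_le.
have lb : (d ^ L <= wsum d S l L + (d - 2))%N.
  have [z zS zL] : exists2 z, z \in S & l z = L.
    have [|z zS zL] := @eq_bigmax_cond _ (mem S) l; last by exists z; rewrite -?zL.
    by apply/card_gt0P; exists z0.
  rewrite leqNgt; apply/negP => lt_sum.
  have sumS : wsum d S l L = (1 + wsum d (S :\ z) l L)%N.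
    by rewrite /wsum (big_setD1 z) //= zL subnn.
  have L_gt0 : (0 < L)%N.
    by rewrite lt0n; apply/eqP => L0; move: lt_sum; rewrite sumS L0; lia.
  pose l2 x := if x == z then L.-1 else l x.
  have l2L : {in S, forall x, (l2 x <= L)%N}.
    by move=> x xS; rewrite /l2; case: eqP => _; [lia | exact: SL].
  have sumS2 : wsum d S l2 L = (d + wsum d (S :\ z) l L)%N.
    rewrite /wsum (big_setD1 z) //= {1}/l2 eqxx (_ : L - L.-1 = 1)%N; last lia.
    rewrite expn1; congr addn; apply: eq_bigr => x /setD1P[/negPf xz _].
    by rewrite /l2 xz.
  have := l_min l2; rewrite kraft_le // sumS2 => l2_min.
  have {l2_min} : \sum_x p x * (l x)%:R <= \sum_x p x * (l2 x)%:R.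
    by apply: l2_min; move: lt_sum; rewrite sumS; lia.
  rewrite leNgt => /negP; apply.
  rewrite (bigD1 z) //= [ltRHS](bigD1 z) //= ltr_leD //; last first.
    by apply: ler_sum => x /negPf xz; rewrite /l2 xz.
  rewrite /l2 eqxx zL ltr_pM2l ?ltr_nat; first lia.
  by move: zS; rewrite inE lt_neqAle eq_sym => ->; exact: p_ge0.
have [t [tree_t lab_t uses_t dep_t]] := tree_of_depths splitQ d_gt0 SL lb ub.
exists t; split=> // [|t' [tree_t' sub_t']].
  by split=> // x; rewrite lab_t.
rewrite (cost_on_support dep_t); apply: l_min.
by apply: kraft_tree.
Qed.

(** For [a <= b] this is [1 + m <= d ^ m] with [m = b - a], scaled by [d ^- b]; for [b < a] the left
    side is not positive. *)
Lemma gibbs_term (R : realType) (d a b : nat) : (1 < d)%N ->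
  d%:R ^- b * (1 + b%:R - a%:R) <= d%:R ^- a :> R /\
  ((b < a)%N -> d%:R ^- b * (1 + b%:R - a%:R) < d%:R ^- a :> R).
Proof.
move=> d_gt1; have d_gt0 : 0 < d%:R :> R by rewrite ltr0n; lia.
have strict : (b < a)%N -> d%:R ^- b * (1 + b%:R - a%:R) < d%:R ^- a :> R.
  move=> lt_ba; apply: (@le_lt_trans _ _ 0); last by rewrite invr_gt0 exprn_gt0.
  apply: mulr_ge0_le0; first by rewrite invr_ge0 exprn_ge0 ?ltW.
  by rewrite subr_le0 addrC natr1 ler_nat.
split=> //; have [le_ab|/strict/ltW //] := leqP a b.
have -> : d%:R ^- a = d%:R ^- b * (d ^ (b - a))%:R :> R.
  rewrite natrX exprB //; last by rewrite unitfE gt_eqF.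
  by rewrite mulrA mulVf ?mul1r // expf_neq0 // gt_eqF.
rewrite ler_pM2l ?invr_gt0 ?exprn_gt0 // -addrA -natrB // addrC natr1 ler_nat.
exact: ltn_expl.
Qed.

(** A form of Gibbs' inequality: the gaps [F] in [gibbs_term] are nonnegative and sum to at most 0,
    which excludes the strict case [b x < a x]. *)
Lemma kraft_gibbs (R : realType) (d n : nat) (S : {set 'I_n}) (a b : 'I_n -> nat) :
  (1 < d)%N -> kraft R d S b = 1 -> kraft R d S a <= 1 ->
  \sum_(x in S) d%:R ^- b x * (a x)%:R <= \sum_(x in S) d%:R ^- b x * (b x)%:R :> R ->
  {in S, forall x, (a x <= b x)%N}.
Proof.
move=> d_gt1 kb ka le_ab x xS.
pose F y : R := d%:R ^- a y - d%:R ^- b y * (1 + (b y)%:R - (a y)%:R).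
have F_ge0 y : y \in S -> 0 <= F y.
  by move=> _; rewrite subr_ge0; have [] := gibbs_term R (a y) (b y) d_gt1.
have sumF : \sum_(y in S) F y <= 0.
  rewrite sumrB subr_le0; apply: le_trans ka _.
  under eq_bigr => y _ do rewrite mulrBr mulrDr mulr1.
  by rewrite sumrB big_split /= -/(kraft R d S b) kb -addrA lerDl subr_ge0.
rewrite leqNgt; apply/negP => lt_ba.
have : 0 < F x by rewrite subr_gt0; have [_] := gibbs_term R (a x) (b x) d_gt1; apply.
apply/negP; rewrite -leNgt; apply: le_trans sumF.
by rewrite (bigD1 x) //= lerDl; apply: sumr_ge0 => y /andP[/F_ge0].
Qed.

Definition code_dist (R : realType) (d n : nat) (S : {set 'I_n}) (l : 'I_n -> nat)
    (x : 'I_n) : R := if x \in S then d%:R ^- l x else 0.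

Lemma support_code_dist (R : realType) (d n : nat) (S : {set 'I_n}) l :
  (0 < d)%N -> Defs.support (code_dist R d S l) = S.
Proof.
move=> d_gt0; apply/setP => x; rewrite inE /code_dist; case: ifP => //.
  by rewrite invr_eq0 expf_neq0 // pnatr_eq0 -lt0n.
by rewrite eqxx.
Qed.

Lemma sum_code_dist (R : realType) (d n : nat) (S : {set 'I_n}) l (P : pred 'I_n) F :
  \sum_(x | P x) code_dist R d S l x * F x =
  \sum_(x in S | P x) d%:R ^- l x * F x.
Proof.
rewrite big_andbC big_mkcondr /=; apply: eq_bigr => x _; rewrite /code_dist.
by case: ifP => // _; rewrite mul0r.
Qed.

Lemma kraft_eq1 (R : realType) (d n L : nat) (S : {set 'I_n}) l : (0 < d)%N ->
  {in S, forall x, (l x <= L)%N} ->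
  (kraft R d S l == 1) = (wsum d S l L == d ^ L)%N.
Proof.
move=> d_gt0 Sl; rewrite -(eqr_nat R) wsumE // natrX -subr_eq0 -[RHS]subr_eq0.
have dL : d%:R ^+ L != 0 :> R by rewrite expf_neq0 // pnatr_eq0 -lt0n.
by rewrite -[X in _ = (_ - X == 0)]mulr1 -mulrBr mulf_eq0 (negPf dL).
Qed.

Lemma distribution_code_dist (R : realType) (d n : nat) (S : {set 'I_n}) l :
  kraft R d S l = 1 -> distribution (code_dist R d S l).
Proof.
move=> kl; split=> [x|].
  by rewrite /code_dist; case: ifP => // _; rewrite invr_ge0 exprn_ge0.
by rewrite -kl /kraft /code_dist -big_mkcond.
Qed.

Lemma sum_eq_max (I : finType) (f : I -> nat) m :
  (forall i, f i <= m)%N -> (\sum_i f i = #|I| * m)%N -> forall i, f i = m.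
Proof.
move=> f_le sum_f i; apply/eqP; rewrite eqn_leq f_le leqNgt; apply/negP => lt_m.
suff : (\sum_i f i < \sum_(i : I) m)%N by rewrite sum_nat_const sum_f ltnn.
rewrite (bigD1 i) //= [ltnRHS](bigD1 i) //= -addSn leq_add // leq_sum //.
Qed.

(** By [kraft_gibbs], an optimal tree has depths at most [l]. Kraft's inequality below the root then
    bounds the mass of each part by [1/d], and as the masses sum to 1 they all equal [1/d]. *)
Lemma optimal_hitting (R : realType) (d n : nat) (Q : {set question d n}) :
  (1 < d)%N -> (d <= n)%N -> optimal R Q -> hitting Q.
Proof.
move=> d_gt1 le_dn optQ S l L Sl sumS; have d_gt0 : (0 < d)%N by lia.
have SlL : {in S, forall x, (l x <= L.+1)%N} by move=> x /Sl /andP[].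
have kl : kraft R d S l = 1 by apply/eqP; rewrite (kraft_eq1 _ d_gt0 SlL) sumS.
have [t [tree_t lab_t _ dep_t]] := tree_of_depths (splitting_setT d_gt1 le_dn) d_gt0
  SlL (leq_trans (eq_leq (esym sumS)) (leq_addr _ _)) (eq_leq sumS).
have [t1 [[tree_t1 sub_t1] uses_t1 min_t1]] := optQ _ (distribution_code_dist kl).
rewrite support_code_dist // in sub_t1.
have := min_t1 t; rewrite /valid /cost !sum_code_dist support_code_dist //.
under eq_bigl => x do rewrite andbT.
under [X in _ -> _ <= X]eq_bigl => x do rewrite andbT.
under [X in _ -> _ <= X]eq_bigr => x xS do rewrite dep_t //.
move/(_ (conj tree_t (fun x xS => etrans (lab_t x) xS))) => le_cost.
have dep_le := kraft_gibbs d_gt1 kl (kraft_tree R d_gt0 tree_t1 sub_t1) le_cost.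
case: t1 tree_t1 sub_t1 uses_t1 {min_t1 le_cost} dep_le => [[x|]|D c].
- move=> _ sub _ _.
  have : S \subset [set x] by apply/subsetP => y /sub; rewrite !inE.
  rewrite subset1 => /orP[]/eqP S1; move: sumS; rewrite S1 /wsum ?big_set0.
    rewrite big_set1 => /eqP; rewrite eqn_exp2l //.
    by have := Sl x; rewrite S1 inE eqxx => /(_ isT); lia.
  by have := expn_gt0 d L.+1; rewrite d_gt0; lia.
- move=> _ sub _ _.
  have S0 : S = set0 by apply/setP => y; rewrite inE; apply/negP => /sub.
  move: sumS; rewrite S0 /wsum big_set0.
  by have := expn_gt0 d L.+1; rewrite d_gt0; lia.
move=> tree_t1 sub_t1 [DQ _] dep_le; exists D => //.
apply: sum_eq_max => [j|]; last first.
  by rewrite -[LHS](wsum_parts D) sumS card_ord expnS.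
have Pl : {in S :&: part D j, forall x, (l x <= L.+1)%N} by move=> x /setIP[/SlL].
rewrite -(ler_nat R) wsumE // natrX exprSr -mulrA ger_pMr ?exprn_gt0 ?ltr0n //.
rewrite mulrC -ler_pdivlMr ?ltr0n // mul1r.
apply: le_trans (kraft_tree_part R j d_gt0 tree_t1 sub_t1).
apply: ler_sum => x /setIP[/dep_le le_x _].
by rewrite lef_pV2 ?posrE ?exprn_gt0 ?ltr0n // ler_weXn2l // ler1n.
Qed.

(** * Densities of Div *)

Lemma mem_Div_code (R : realType) (d n L : nat) (S : {set 'I_n}) l (D : question d n) :
  (0 < d)%N -> {in S, forall x, (l x <= L.+1)%N} ->
  (D \in Div d (code_dist R d S l)) =
  [forall j, wsum d (S :&: part D j) l L.+1 == d ^ L]%N.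
Proof.
move=> d_gt0 Sl; rewrite inE; apply: eq_forallb => j.
have d0 : d%:R != 0 :> R by rewrite pnatr_eq0 -lt0n.
rewrite -(eqr_nat R) wsumE => [||x /setIP[/Sl]] //.
have -> : \sum_(x in part D j) code_dist R d S l x = kraft R d (S :&: part D j) l.
  rewrite /code_dist -big_mkcondr; apply: eq_bigl => x.
  by rewrite !inE andbC.
rewrite natrX exprSr -mulrA -[X in _ = (_ == X)]mulr1.
by rewrite (inj_eq (mulfI (expf_neq0 _ d0))) -(inj_eq (mulfI d0) _ d%:R^-1) mulfV.
Qed.

Lemma dadic_code (R : realType) (d n : nat) (mu : 'I_n -> R) :
  (0 < d)%N -> dadic d mu -> nonconstant mu ->
  exists (S : {set 'I_n}) l L, [/\ mu = code_dist R d S l,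
    {in S, forall x, (0 < l x <= L.+1)%N} & wsum d S l L.+1 = (d ^ L.+1)%N].
Proof.
move=> d_gt0 [[mu_ge0 sum_mu] mu_d] mu_nc.
have /fin_all_exists[l lE] x : exists m, mu x != 0 -> (0 < m)%N /\ mu x = d%:R ^- m.
  have [->|mux] := eqVneq (mu x) 0.
    by exists 0%N.
  by have [m] := mu_d x mux; exists m.
pose L := (\max_x l x)%N.
have Sl : {in Defs.support mu, forall x, (0 < l x <= L.+1)%N}.
  move=> x; rewrite inE => /lE[-> _] /=.
  exact: leq_trans (leq_bigmax x) (leqnSn _).
have muE : mu = code_dist R d (Defs.support mu) l.
  apply: funext => x; rewrite /code_dist inE.
  by case: (eqVneq (mu x) 0) => // /lE[].
exists (Defs.support mu), l, L; split=> //.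
apply/eqP; rewrite -(@kraft_eq1 R) // => [|x /Sl/andP[]//].
rewrite -sum_mu [in X in _ == X]muE /kraft /code_dist -big_mkcond.
exact/eqP.
Qed.

Lemma code_dadic (R : realType) (d n L : nat) (S : {set 'I_n}) l :
  (1 < d)%N -> {in S, forall x, (0 < l x <= L.+1)%N} ->
  wsum d S l L.+1 = (d ^ L.+1)%N ->
  dadic d (code_dist R d S l) /\ nonconstant (code_dist R d S l).
Proof.
move=> d_gt1 Sl sumS; have d_gt0 : (0 < d)%N by lia.
have SlL : {in S, forall x, (l x <= L.+1)%N} by move=> x /Sl /andP[].
split; first split.
- by apply: distribution_code_dist; apply/eqP; rewrite (kraft_eq1 _ d_gt0 SlL) sumS.
- move=> x; rewrite /code_dist; case: ifP => [/Sl/andP[lx _] _|]; last by rewrite eqxx.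
  by exists (l x).
rewrite /nonconstant support_code_dist //.
have [S0|[x xS]] := set_0Vmem S.
  by move: sumS; rewrite S0 /wsum big_set0; have := expn_gt0 d L.+1; lia.
(* A positive depth below [#|S|] forces two elements. *)
apply: leq_trans (depth_lt_card d_gt1 SlL sumS xS).
by case/andP: (Sl x xS).
Qed.

Lemma rho_at_le (R : realType) (d n : nat) (A : {set question d n}) k :
  k \in sizes d n -> rho_at R k A <= rho R A.
Proof.
by move=> kK; rewrite /rho; exact: (le_bigmax_cond 0 (fun k => rho_at R k A) kK).
Qed.

Lemma wsum_qperm (d n L : nat) (S : {set 'I_n}) l (D : question d n)
    (s : {perm 'I_n}) j :
  wsum d (S :&: part (qperm D s) j) l L =
  wsum d ((s^-1)%g @^-1: S :&: part D j) (fun x => l ((s^-1)%g x)) L.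
Proof.
rewrite /wsum [RHS](reindex_inj (@perm_inj _ s)) /=; apply: eq_big => x.
  by rewrite !inE ffunE permK.
by rewrite permK.
Qed.

(* The images of Div mu under the permutations of X_n are all of the form
   Div mu', so Q meets each of them; a question of type k lies in a fraction
   rho_k(Div mu) of these images. *)
Lemma hitting_card_ge (R : realType) (d n L : nat) (Q : {set question d n})
    (S : {set 'I_n}) l :
  (1 < d)%N -> hitting Q -> {in S, forall x, (0 < l x <= L.+1)%N} ->
  wsum d S l L.+1 = (d ^ L.+1)%N ->
  1 <= #|Q|%:R * rho R (Div d (code_dist R d S l)).
Proof.
move=> d_gt1 hitQ Sl sumS; have d_gt0 : (0 < d)%N by lia.
set A := Div _ _.
(* Moving the code by [s] gives another code; if [D] splits it evenly, then [qperm D s] splits the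
   original one. *)
have meet (s : {perm 'I_n}) : exists2 D, D \in Q & qperm D s \in A.
  have [||D DQ DE] := hitQ ((s^-1)%g @^-1: S) (fun x => l ((s^-1)%g x)) L.
  - by move=> x; rewrite inE => /Sl.
  - rewrite -sumS /wsum [LHS](reindex_inj (@perm_inj _ s)) /=.
    by apply: eq_big => x; rewrite ?inE permK.
  exists D => //; rewrite (@mem_Div_code R d n L) // => [|x /Sl/andP[]//].
  by apply/forallP => j; rewrite wsum_qperm DE.
have n_gt0 : 0 < n`!%:R :> R by rewrite ltr0n fact_gt0.
have cardE (D : question d n) :
    #|[set s | qperm D s \in A]|%:R <= rho R A * n`!%:R.
  have [_ m_gt0] := multinomial_mul (type_of_sizes D).
  apply: le_trans (ler_wpM2r (ltW n_gt0) (rho_at_le R A (type_of_sizes D))).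
  rewrite /rho_at mulrAC ler_pdivlMr ?ltr0n // -!natrM ler_nat.
  by rewrite card_qperm.
rewrite -(ler_pM2r n_gt0) mul1r -mulrA.
(* Double count of the pairs [(D, s)] with [qperm D s] in [A]: every [s] occurs at least once. *)
apply: (@le_trans _ _ (\sum_(D in Q) #|[set s | qperm D s \in A]|%:R)); last first.
  by rewrite mulr_natl -sumr_const; apply: ler_sum => D _.
rewrite -natr_sum ler_nat -[X in (X <= _)%N]card_Sn -[X in (X <= _)%N]sum1_card.
under [X in (_ <= X)%N]eq_bigr => D _ do rewrite -sum1dep_card big_mkcond.
rewrite exchange_big /=; apply: leq_sum => s _.
by have [D DQ Ds] := meet s; rewrite (bigD1 D) //= Ds.
Qed.

(** Any [d] elements at depth 1 form a code that [Q] must split. *)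
Lemma hitting_neq0 (d n : nat) (Q : {set question d n}) :
  (d <= n)%N -> hitting Q -> (0 < #|Q|)%N.
Proof.
move=> le_dn hitQ.
have [|S _ cS] := @subset_of_card _ [set: 'I_n] d; first by rewrite cardsT card_ord.
have [//||D DQ _] := hitQ S (fun=> 1%N) 0%N.
  by rewrite (@wsum_const d n S _ _ 1%N) // cS muln1 expn1.
by apply/card_gt0P; exists D.
Qed.

(** Besides the lower bound, this yields positivity of [rho_min], by taking all questions for
    [Q]. *)
Lemma rho_min_ge (R : realType) (d n : nat) (Q : {set question d n}) :
  (1 < d)%N -> (d <= n)%N -> hitting Q -> (#|Q|%:R)^-1 <= rho_min R d n.
Proof.
move=> d_gt1 le_dn hitQ; have Q_gt0 := hitting_neq0 le_dn hitQ.
apply: le_bigmin => [|A /asboolP[mu [mu_d mu_nc <-]]].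
  by rewrite invf_le1 ?ltr0n // ler1n.
have [S [l [L [-> Sl sumS]]]] := dadic_code (ltnW d_gt1) mu_d mu_nc.
by rewrite -div1r ler_pdivrMr ?ltr0n // mulrC; apply: hitting_card_ge sumS.
Qed.

Lemma rho_min_le (R : realType) (d n L : nat) (S : {set 'I_n}) l :
  (1 < d)%N -> {in S, forall x, (0 < l x <= L.+1)%N} ->
  wsum d S l L.+1 = (d ^ L.+1)%N ->
  rho_min R d n <= rho R (Div d (code_dist R d S l)).
Proof.
move=> d_gt1 Sl sumS; apply: bigmin_le_cond; apply/asboolP.
by exists (code_dist R d S l); have [] := code_dadic R d_gt1 Sl sumS.
Qed.

(* Greedily pick a point that lies in a fraction rho of the sets not yet met. *)
Lemma greedy_hitting (R : realType) (U : finType) (X : {set U}) (rho : R) (N : nat)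
    (F : {set {set U}}) :
  rho <= 1 -> (forall A, A \in F -> rho * #|X|%:R <= #|A :&: X|%:R) ->
  (0 < #|X|)%N -> #|F|%:R * (1 - rho) ^+ N < 1 ->
  exists2 H : {set U}, (#|H| <= N)%N &
    forall A, A \in F -> exists2 u, u \in A & u \in H.
Proof.
move=> rho_le1; elim: N F => [|N IHN] F dens X_gt0.
  rewrite expr0 mulr1 ltrn1 => F0; exists set0; first by rewrite cards0.
  by move=> A; move: F0; rewrite ltnS leqn0 cards_eq0 => /eqP->; rewrite inE.
move=> small; have rho_ge0 : 0 <= 1 - rho by rewrite subr_ge0.
(* Averaging over [X]: by [dens] there are at least [rho * #|X| * #|F|] incidences between points of
   [X] and sets in [F]. *)
have [u uX hu] : exists2 u, u \in X & rho * #|F|%:R <= #|[set A in F | u \in A]|%:R.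
  apply/exists_inP; apply: contraT; rewrite negb_exists_in => /forall_inP none.
  have : \sum_(u in X) #|[set A in F | u \in A]|%:R < \sum_(u in X) rho * #|F|%:R.
    have [u uX] := card_gt0P X_gt0.
    rewrite (bigD1 u) //= [ltRHS](bigD1 u) //= ltr_leD // ?ltNge ?none //.
    by apply: ler_sum => v /andP[vX _]; rewrite ltW // ltNge none.
  rewrite ltNge => /negP[].
  have -> : \sum_(v in X) rho * #|F|%:R = \sum_(A in F) rho * #|X|%:R.
    by rewrite !sumr_const -[LHS]mulr_natr -[RHS]mulr_natr mulrAC.
  apply: le_trans (ler_sum _ dens) _; rewrite -!natr_sum ler_nat.
  have -> : (\sum_(A in F) #|A :&: X| = \sum_(A in F) \sum_(v in X) (v \in A))%N.
    apply: eq_bigr => A _; rewrite -sum1_card -big_mkcondr.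
    by apply: eq_bigl => v; rewrite inE andbC.
  rewrite exchange_big /=; apply: leq_sum => v _.
  rewrite -sum1_card -big_mkcondr leq_eqVlt; apply/orP; left; apply/eqP.
  by apply: eq_bigl => A; rewrite inE.
pose F' := [set A in F | u \notin A].
have cF : #|F'|%:R <= (1 - rho) * #|F|%:R.
  have : #|F| = (#|[set A in F | u \in A]| + #|F'|)%N.
    rewrite -(cardsID [set A : {set U} | u \in A] F); congr addn; apply: eq_card => A.
      by rewrite !inE.
    by rewrite !inE andbC.
  by move=> /(congr1 (fun m => m%:R : R)); rewrite natrD; lra.
have [|//||H cH hH] := IHN F'.
- by move=> A; rewrite inE => /andP[/dens].
- apply: le_lt_trans small; rewrite exprS mulrA ler_wpM2r ?exprn_ge0 //.
  by rewrite mulrC.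
exists (u |: H) => [|A AF]; first by rewrite cardsU1; case: (_ \notin _); lia.
have [uA|uA] := boolP (u \in A); first by exists u; rewrite // setU11.
have [|v vA vH] := hH A; first by rewrite inE AF.
by exists v; rewrite // setU1r.
Qed.

(** * Small hitting sets *)

(** The value 0 marks elements outside the support, and depths below [n] suffice by [depth_lt_card].
    Functions [f] whose Kraft sum is not 1 are kept, which keeps the count simple. *)
Definition codes (R : realType) (d n : nat) : {set {set question d n}} :=
  [set Div d (code_dist R d [set x | 0 < f x]%N (fun x => f x : nat))
     | f : {ffun 'I_n -> 'I_n}].

Lemma card_codes (R : realType) (d n : nat) : (#|codes R d n| <= n ^ n)%N.
Proof.
by apply: leq_trans (leq_imset_card _ _) _; rewrite card_ffun !card_ord.
Qed.

Lemma mem_codes (R : realType) (d n L : nat) (S : {set 'I_n}) l :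
  (1 < d)%N -> {in S, forall x, (0 < l x <= L.+1)%N} ->
  wsum d S l L.+1 = (d ^ L.+1)%N ->
  Div d (code_dist R d S l) \in codes R d n.
Proof.
move=> d_gt1 Sl sumS.
have SlL : {in S, forall x, (l x <= L.+1)%N} by move=> x /Sl /andP[].
have l_lt x : ((if x \in S then l x else 0) < n)%N.
  case: ifP => [xS|_]; last exact: leq_ltn_trans (leq0n x) (ltn_ord x).
  apply: leq_trans (depth_lt_card d_gt1 SlL sumS xS) _.
  by rewrite -[X in (_ <= X)%N]card_ord max_card.
apply/imsetP; exists [ffun x => Ordinal (l_lt x)] => //; congr (Div d _).
apply: funext => x; rewrite /code_dist inE ffunE /=.
by case: ifP => [/Sl/andP[-> _]|].
Qed.

Lemma hitting_exists (R : realType) (d n N : nat) :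
  (1 < d)%N -> (d <= n)%N ->
  n%:R ^+ n * (1 - rho_min R d n) ^+ N < 1 ->
  exists2 Q : {set question d n}, (#|Q| <= n ^ d * N)%N & hitting Q.
Proof.
move=> d_gt1 le_dn small; have d_gt0 : (0 < d)%N by lia.
set r := rho_min R d n in small *.
have r_gt0 : 0 < r.
  apply: lt_le_trans (rho_min_ge R d_gt1 le_dn (@hitting_setT d n d_gt1)).
  by rewrite invr_gt0 ltr0n; apply: hitting_neq0 (@hitting_setT d n d_gt1).
have r_le1 : r <= 1 by apply: bigmin_le_id.
(* Only types without empty parts matter, so there are [n ^ d] candidates instead of
   [(n + 1) ^ d]. *)
pose kof (h : {ffun 'I_d -> 'I_n}) : {ffun 'I_d -> 'I_n.+1} :=
  [ffun i => lift ord0 (h i)].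
have /fin_all_exists[H HE] h : exists H : {set question d n},
    (#|H| <= N)%N /\ (kof h \in sizes d n -> forall A, A \in codes R d n ->
      r <= rho_at R (kof h) A -> exists2 D, D \in A & D \in H).
  have [kK|] := boolP (kof h \in sizes d n); last by exists set0; rewrite cards0.
  have [cX m_gt0] := multinomial_mul kK.
  have [|||H0 cH0 hH0] := @greedy_hitting R _ (of_sizes setT (kof h)) r N
    [set A in codes R d n | r <= rho_at R (kof h) A] r_le1.
  - move=> A; rewrite inE => /andP[_]; rewrite /rho_at ler_pdivlMr ?ltr0n // cX.
    move/le_trans; apply; rewrite ler_nat subset_leq_card //.
    by apply/subsetP => D; rewrite !inE => /andP[-> ->].
  - by rewrite cX.
  - apply: le_lt_trans small; rewrite ler_wpM2r ?exprn_ge0 ?subr_ge0 //.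
    rewrite -natrX ler_nat; apply: leq_trans (card_codes R d n).
    by rewrite subset_leq_card //; apply/subsetP => A; rewrite inE => /andP[].
  exists H0; split=> // _ A Ac rA; apply: hH0; by rewrite inE Ac.
exists (\bigcup_h H h).
  apply: (@leq_trans (\sum_h #|H h|)).
    elim/big_rec2: _ => [|h m B _ le_m]; first by rewrite cards0.
    by apply: leq_trans (leq_card_setU _ _) _; rewrite leq_add2l.
  rewrite -[X in (_ <= X ^ d * _)%N]card_ord -[X in (_ <= _ ^ X * _)%N]card_ord.
  rewrite -card_ffun -sum_nat_const; apply: leq_sum => h _.
  by have [] := HE h.
move=> S l L Sl sumS; set A := Div d (code_dist R d S l).
have Ac : A \in codes R d n := mem_codes R d_gt1 Sl sumS.
have SlL : {in S, forall x, (l x <= L.+1)%N} by move=> x /Sl /andP[].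
have AE D : D \in A -> forall j, wsum d (S :&: part D j) l L.+1 = (d ^ L)%N.
  by rewrite (@mem_Div_code R d n L) // => /forallP DE j; apply/eqP.
(* The maximum [rho] starts from 0, so as [r > 0] some type [k] has density at least [r]. *)
have /bigmax_geP[|[k kK rk]] := rho_min_le R d_gt1 Sl sumS.
  by rewrite -/r leNgt r_gt0.
have [D0 D0A /eqP D0k] : exists2 D, D \in A & type_of D == k.
  have /card_gt0P[D] : (0 < #|of_sizes A k|)%N.
    rewrite lt0n; apply: contraTneq (lt_le_trans r_gt0 rk) => A0.
    by rewrite /rho_at A0 mul0r ltxx.
  by rewrite mem_of_sizes => /andP[DA Dk]; exists D.
(* Each part of a question in [A] weighs [d ^ L > 0], hence is nonempty. *)
have /fin_all_exists[h hE] i : exists m : 'I_n, k i = lift ord0 m.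
  have /unlift_some[m -> _] : ord0 != k i; last by exists m.
  apply/eqP => k0; have := AE D0 D0A i.
  have -> : part D0 i = set0.
    by apply/eqP; rewrite -cards_eq0 -type_ofE D0k -k0.
  by rewrite setI0 /wsum big_set0; have := expn_gt0 d L; rewrite d_gt0; lia.
have kh : k = kof (finfun h) by apply/ffunP => i; rewrite !ffunE.
have [_ /(_ _ A Ac)] := HE (finfun h); rewrite -kh => /(_ kK rk)[D DA DH].
exists D; last exact: AE.
by apply/bigcupP; exists (finfun h).
Qed.

(** * The two bounds *)

Lemma qmin_optimal (R : realType) (d n : nat) : (1 < d)%N -> (d <= n)%N ->
  (exists2 Q : {set question d n}, optimal R Q & qmin R d n = #|Q|) /\
  forall Q : {set question d n}, optimal R Q -> (qmin R d n <= #|Q|)%N.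
Proof.
move=> d_gt1 le_dn; rewrite /qmin.
case: fintype.arg_minnP => [|Q /asboolP optQ Q_min].
  by apply/asboolP/splitting_optimal => //; apply: splitting_setT.
by split=> [|Q' optQ']; [exists Q | apply: Q_min; apply/asboolP].
Qed.

(** From [ln (1 + x) <= x] at [x = 1/n - 1], which gives [n ln n >= n - 1]. *)
Lemma mul_ln_ge1 (R : realType) (n : nat) : (1 < n)%N -> 1 <= n%:R * ln n%:R :> R.
Proof.
move=> n_gt1; have n_gt0 : 0 < n%:R :> R by rewrite ltr0n; lia.
have n_ge2 : 2 <= n%:R :> R by rewrite ler_nat.
have : ln (1 + - (1 - n%:R^-1)) <= - (1 - n%:R^-1) :> R.
  by apply: le_ln1Dx; rewrite ltrN2 gtrDl oppr_lt0 invr_gt0.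
rewrite opprB addrC subrK lnV ?posrE // => ln_le.
have : n%:R * (1 - n%:R^-1) <= n%:R * ln n%:R :> R.
  by rewrite ler_pM2l // -[leRHS]opprK lerNr opprB.
by rewrite mulrBr mulr1 mulfV ?gt_eqF //; lra.
Qed.

(** [n ^ n] is the exponential of [n ln n], and [1 - r] is at most that of [-r]. *)
Lemma draws_suffice (R : realType) (n N : nat) (r : R) : (0 < n)%N ->
  0 < r <= 1 -> n%:R * ln n%:R / r < N%:R -> n%:R ^+ n * (1 - r) ^+ N < 1.
Proof.
move=> n_gt0 /andP[r_gt0 r_le1]; rewrite ltr_pdivrMr // => lt_N.
have nn : n%:R ^+ n = expR (n%:R * ln n%:R) :> R.
  by rewrite expRM_natl lnK // posrE ltr0n.
have le_exp : (1 - r) ^+ N <= expR (- (N%:R * r)).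
  rewrite -mulrN expRM_natl.
  by rewrite lerXn2r ?nnegrE ?subr_ge0 ?expR_ge0 // expR_ge1Dx.
rewrite nn; apply: le_lt_trans (ler_wpM2l (expR_ge0 _) le_exp) _.
by rewrite -expRD expR_lt1 subr_lt0.
Qed.

Theorem theorem6p8 (R : realType) (d n : nat) (hd : (2 <= d)%N)
    (hdn : (d <= n)%N) :
  1 / rho_min R d n <= (qmin R d n)%:R /\
  (qmin R d n)%:R <= 2 * n%:R ^+ (2 * d) * ln n%:R / rho_min R d n.
Proof.
have [[Q optQ qE] q_le] := qmin_optimal R hd hdn.
have hitQ := optimal_hitting hd hdn optQ.
have Q_gt0 : 0 < #|Q|%:R :> R by rewrite ltr0n hitting_neq0.
have le_r := rho_min_ge R hd hdn hitQ; set r := rho_min R d n in le_r *.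
have r_gt0 : 0 < r by apply: lt_le_trans le_r; rewrite invr_gt0.
have r_le1 : r <= 1 by apply: bigmin_le_id.
split; first by rewrite qE div1r -[leRHS]invrK lef_pV2 ?posrE ?invr_gt0.
have n_gt1 : (1 < n)%N by lia.
(* [N] is the least integer exceeding [X]; as [X >= 1], it is at most [2 * X], whence the constant
   2. *)
pose X := n%:R * ln n%:R / r; pose N := (Num.truncn X).+1.
have X_ge1 : 1 <= X.
  rewrite /X ler_pdivlMr // mul1r; apply: le_trans r_le1 _; exact: mul_ln_ge1.
have N_le : N%:R <= 2 * X.
  have : (Num.truncn X)%:R <= X by rewrite truncn_le //; lra.
  by rewrite /N -natr1; lra.
have [|Q0 cQ0 hitQ0] := @hitting_exists R d n N hd hdn.
  by apply: draws_suffice; [lia | rewrite r_gt0 | exact: truncnS_gt].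
have optQ0 := splitting_optimal (R := R) hd (splitting_gathered hd hdn hitQ0).
(* The exponent is [1 + (d - 2)] from gathering plus [d] from the types; the last factor [n] comes
   from [n ln n]. *)
have q_leN : (qmin R d n <= n ^ (2 * d - 1) * N)%N.
  apply: leq_trans (q_le _ optQ0) (leq_trans (card_gathered _) _).
  apply: leq_trans (leq_mul (leqnn _) cQ0) _.
  rewrite -expnS mulnA -expnD leq_mul2r leq_exp2l //; lia.
apply: (@le_trans _ _ (n ^ (2 * d - 1) * N)%N%:R); first by rewrite ler_nat.
rewrite natrM natrX.
apply: le_trans (ler_wpM2l (exprn_ge0 _ (ler0n _ _)) N_le) _.
rewrite (_ : (2 * d = (2 * d - 1).+1)%N) ?subSS ?subn0; last lia.
by rewrite exprSr /X !mulrA [2 * _]mulrC.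
Qed.
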